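(* Let $G$ be a group with neutral element $e$, and let $\Delta=\bigoplus_{g\in G}\Delta_g$ be a finite dimensional $G$-graded division algebra over a field $k$ such that $Z(\Delta_e)=Z(\Delta)\cap\Delta_e$. Then $\Delta$ is graded symmetric.
   Context: $Z(R)$ denotes the center of a ring $R$. A graded division algebra is a non-zero graded algebra in which every non-zero homogeneous element is invertible. For a finite dimensional $G$-graded algebra $A$, the dual space $A^*=\mathrm{Hom}_k(A,k)$ is a graded left-$A$, right-$A$ bimodule with $(af)(x)=f(xa)$, $(fa)(x)=f(ax)$ and grading $(A^* )_g=\{f\in A^* \mid f(A_h)=0 \text{ for any } h\neq g^{-1}\}$. A finite dimensional graded algebra $A$ is graded symmetric if $A$ and $A^*$ are isomorphic as graded left-$A$, right-$A$ bimodules (via a degree-preserving bimodule isomorphism). *)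

(* Defs.v *)
From mathcomp Require Import all_boot all_order all_fingroup all_algebra all_field.

Set Implicit Arguments.
Unset Strict Implicit.
Unset Printing Implicit Defensive.

Import GRing.Theory.

Local Open Scope ring_scope.

(* G may be infinite: the sum of the D g is the union of its finite partial
   sums, and it is direct when all its finite subsums are. *)
Record is_graded_algebra (k : fieldType) (G : groupType) (A : falgType k)
    (D : G -> {vspace A}) : Prop := IsGradedAlgebra {
  grading_span : forall x : A, exists s : seq G, x \in (\sum_(g <- s) D g)%VS;
  grading_direct : forall s : seq G, uniq s -> directv (\sum_(g <- s) D g);
  grading_mul : forall g h : G, (D g * D h <= D (g * h)%g)%VS }.

(* A falgType is non-zero by construction, as it is an nzRingType. *)
Record is_graded_division_algebra (k : fieldType) (G : groupType)
    (A : falgType k) (D : G -> {vspace A}) : Prop := IsGradedDivisionAlgebra {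
  gdiv_graded : is_graded_algebra D;
  gdiv_unit : forall (g : G) (x : A),
    x \in D g -> x != 0 -> x \is a GRing.unit }.

Section Dual.

Variables (k : fieldType) (A : falgType k).

Definition dual_lmul (a : A) (f : 'Hom(A, k^o)) : 'Hom(A, k^o) :=
  (f \o amulr a)%VF.

Definition dual_rmul (f : 'Hom(A, k^o)) (a : A) : 'Hom(A, k^o) :=
  (f \o amull a)%VF.

Lemma dual_lmulE a f x : dual_lmul a f x = f (x * a).
Proof. by rewrite !lfunE /= lfunE. Qed.

Lemma dual_rmulE f a x : dual_rmul f a x = f (a * x).
Proof. by rewrite !lfunE /= lfunE. Qed.

Definition dual_component (G : groupType) (D : G -> {vspace A}) (g : G)
    (f : 'Hom(A, k^o)) : Prop :=
  forall h : G, h <> (g^-1)%g -> forall x, x \in D h -> f x = 0.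

Definition graded_symmetric (G : groupType) (D : G -> {vspace A}) : Prop :=
  exists phi : {linear A -> 'Hom(A, k^o)},
    [/\ bijective phi,
        forall a x : A, phi (a * x) = dual_lmul a (phi x),
        forall a x : A, phi (x * a) = dual_rmul (phi x) a
      & forall (g : G) (x : A), x \in D g -> dual_component D g (phi x)].

End Dual.

(* Main.v *)
From HB Require Import structures.
Require Import Defs.
From mathcomp Require Import all_boot all_order all_fingroup all_algebra all_field.

(** Let E be the component of degree 1, a finite-dimensional division algebra
    with centre Z. A graded bimodule isomorphism of Delta with its dual is the
    same thing as a linear form lam on Delta that vanishes outside degree 1,
    satisfies lam (x * y) = lam (y * x), and is nonzero: the kernel of
    a |-> (x |-> lam (x * a)) contains no nonzero element a, because a nonzero
    homogeneous component of a is invertible and so x * a can be given any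
    prescribed component of degree 1.

    It therefore suffices to find a nonzero form on E that vanishes on
    commutators of E and is invariant under conjugation by nonzero homogeneous
    elements of Delta. Conjugation by such an element restricts to an
    automorphism of E, which fixes Z pointwise because Z is central in Delta.
    Classically one now quotes two theorems on the central simple Z-algebra E:
    by Skolem-Noether the automorphism is inner on E, so invariance follows from
    vanishing on commutators; and the reduced trace shows that the commutators
    do not span E.

    Both facts are obtained here from one Casimir element
    t = sum_i a_i (x) b_i of E (x)_Z E, that is, one with
    sum_i c a_i (x) b_i = sum_i a_i (x) b_i c for all c in E. For m in Delta the
    element sum_i a_i m b_i commutes with E, and for a suitable m it is a nonzero
    element of any prescribed nonzero D g; this replaces Skolem-Noether. The map
    x |-> sum_i b_i x a_i kills the commutators of E and is nonzero, so composing
    it with a linear form replaces the reduced trace.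

    To build t, take an operator x |-> sum_i a_i x b_i on E of minimal nonzero
    rank. After a scaling, 1 is in its image; the commutator with any c in E then
    has smaller rank, so the operator has values in Z
    ([exists_central_sandwich]). Call tau this Z-linear map E -> Z. Expanding
    tau twice gives, for s = sum_i tau(a_i) b_i,

      sum_i tau(y a_i) b_i = s y   and   sum_i tau(b_i y) a_i = y s,

    so that, when s is nonzero, the a_i and the b_i behave like dual bases for
    tau up to s. If s = 0, the second identity is a Z-linear dependence between
    the a_i, and t can be shortened ([exists_frobenius_sandwich]). The Casimir
    identity is then the expansion of c a_i along the a_j and of b_j c along the
    b_i ([casimir_balanced]). *)

Set Implicit Arguments.
Unset Strict Implicit.
Unset Printing Implicit Defensive.

Import GRing.Theory.

Local Open Scope ring_scope.

(** * Two-sided multiplication operators *)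

Section Sandwich.

Variables (k : fieldType) (A : falgType k).
Implicit Types (t : seq (A * A)) (m x y c : A).

(** The list [t] stands for the tensor sum_p p.1 (x) p.2; a list of pairs, and
    not an element of a tensor product, so that its length can be inducted on. *)
Definition sandwich t x := \sum_(p <- t) p.1 * x * p.2.

Definition flip t := [seq (p.2, p.1) | p <- t].

Lemma sandwich_is_linear t : linear (sandwich t).
Proof.
move=> a x y; rewrite /sandwich scaler_sumr -big_split /=.
by apply: eq_bigr => p _; rewrite mulrDr mulrDl -scalerAr -scalerAl.
Qed.

HB.instance Definition _ t :=
  GRing.isLinear.Build k A A _ (sandwich t) (sandwich_is_linear t).

Lemma sandwich_flip t x : sandwich (flip t) x = \sum_(p <- t) p.2 * x * p.1.
Proof. by rewrite /sandwich big_map. Qed.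

End Sandwich.

(** * Casimir elements of a division subalgebra *)

Section DivisionSubalgebra.

Variables (k : fieldType) (A : falgType k) (E : {aspace A}).
Hypothesis unitE : {in E, forall x, x != 0 -> x \is a GRing.unit}.
Implicit Types (t : seq (A * A)) (m x y c : A).

Let over t := {in t, forall p, p.1 \in E /\ p.2 \in E}.

Lemma division_mem1 : 1 \in E.
Proof.
rewrite -algid_eq1; apply/eqP; apply: unitr_algid1 (memv_algid E) _.
by rewrite unitE ?memv_algid ?algid_neq0.
Qed.

Lemma mem_sandwich t x : over t -> x \in E -> sandwich t x \in E.
Proof.
move=> tE Ex; rewrite /sandwich big_seq; apply: memv_suml => p /tE[p1 p2].
by rewrite !memvM.
Qed.

(** Composing an operator whose image contains 1 with x |-> c * x - x * c kills
    1, so it lowers the rank; an operator of minimal nonzero rank is therefore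
    central-valued. Scaling by [w^-1] puts 1 back into the image. *)
Lemma exists_central_sandwich : exists t,
  [/\ over t, {in E, forall x, sandwich t x \in 'Z(E)%VS}
    & exists2 x, x \in E & sandwich t x != 0].
Proof.
suff: forall r t, (\dim (linfun (sandwich t) @: E) < r)%N -> over t ->
    (exists2 x, x \in E & sandwich t x = 1) ->
  exists t', [/\ over t', {in E, forall x, sandwich t' x \in 'Z(E)%VS}
    & exists2 x, x \in E & sandwich t' x != 0].
  move/(_ _ [:: (1, 1)] (ltnSn _)); apply.
  - by move=> p; rewrite mem_seq1 => /eqP->; split; exact: division_mem1.
  - by exists 1; rewrite ?division_mem1 // /sandwich big_seq1 !mulr1.
elim=> [//|r IHr] t rt tE [x0 Ex0 tx0].
pose I := (linfun (sandwich t) @: E)%VS.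
have IP x : x \in E -> sandwich t x \in I.
  by move=> Ex; rewrite -[sandwich t x]lfunE memv_img.
have [/subvP cent|/subvPn[v Iv]] := boolP (I <= 'C(E))%VS.
  exists t; split=> //; last by exists x0; rewrite // tx0 oner_neq0.
  by move=> x Ex; rewrite memv_cap mem_sandwich ?cent ?IP.
rewrite -subv_cent1 => /subvPn[c Ec /cent1vP/eqP ncv].
have [x1 Ex1 def_v] := memv_imgP Iv; rewrite lfunE /= in def_v.
pose w := c * v - v * c.
have nzw : w != 0 by rewrite subr_eq0.
have Ew : w \in E by rewrite /w def_v memvB ?memvM ?mem_sandwich.
pose t' := [seq (w^-1 * c * p.1, p.2) | p <- t]
        ++ [seq (- (w^-1 * p.1), p.2 * c) | p <- t].
have t'E x : sandwich t' x = w^-1 * (c * sandwich t x - sandwich t x * c).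
  rewrite /sandwich big_cat !big_map /= mulrBr; congr (_ + _).
    by rewrite !mulr_sumr; apply: eq_bigr => p _; rewrite !mulrA.
  rewrite mulr_suml mulr_sumr -sumrN; apply: eq_bigr => p _.
  by rewrite !mulNr !mulrA.
apply: (IHr t').
- pose g := (amull (w^-1)%R \o (amull c - amulr c))%VF.
  have gE x : g x = w^-1 * (c * x - x * c).
    by rewrite comp_lfunE lfunE /= add_lfunE opp_lfunE !lfunE.
  have -> : (linfun (sandwich t') @: E = g @: I)%VS.
    rewrite -limg_comp; apply: eq_in_limg => x Ex.
    by rewrite comp_lfunE !(lfunE (sandwich _)) /= gE t'E.
  rewrite ltnS in rt; apply: leq_trans rt.
  rewrite -(limg_ker_dim g I) -[X in (X < _)%N]add0n ltn_add2r lt0n dimv_eq0.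
  have: 1 \in (I :&: lker g)%VS.
    rewrite memv_cap memv_ker gE mulr1 mul1r subrr mulr0 eqxx andbT.
    by rewrite -tx0 IP.
  by apply: contraL => /eqP->; rewrite memv0 oner_eq0.
- move=> p; rewrite mem_cat.
  case/orP=> /mapP[q /tE[q1 q2] ->] /=; split; rewrite ?memvN //;
  by do ?rewrite memvM ?memvV.
- by exists x1; rewrite // t'E -def_v mulVr ?unitE.
Qed.

Lemma mem_frobenius_scalar t :
  over t -> \sum_(p <- t) sandwich t p.1 * p.2 \in E.
Proof.
move=> tE; rewrite big_seq; apply: memv_suml => p /tE[p1 p2].
by rewrite memvM ?mem_sandwich.
Qed.

Lemma centerE z x : z \in 'Z(E)%VS -> x \in E -> z * x = x * z.
Proof. by rewrite memv_cap => /andP[_ /centvP]; apply. Qed.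

Lemma sandwich_center t z x : over t -> z \in 'Z(E)%VS -> x \in E ->
  sandwich t (z * x) = z * sandwich t x.
Proof.
move=> tE Zz Ex; rewrite /sandwich mulr_sumr big_seq [RHS]big_seq.
by apply: eq_bigr => p /tE[p1 _]; rewrite !mulrA (centerE Zz p1).
Qed.

Section Casimir.


Variable t : seq (A * A).
Hypotheses (tE : over t) (tZ : {in E, forall x, sandwich t x \in 'Z(E)%VS}).

Let tau := sandwich t.
Let s := \sum_(p <- t) tau p.1 * p.2.

(** Moving the central factor tau (p.2 * y) between p.1 and its partner turns the
    sum into a double sum that regroups around sandwich t q.1 = tau q.1. *)
Lemma frobenius_expandl y :
  y \in E -> \sum_(p <- t) tau (p.2 * y) * p.1 = y * s.
Proof.
move=> Ey; transitivity (\sum_(p <- t) \sum_(q <- t) p.1 * q.1 * p.2 * y * q.2).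
  rewrite big_seq [RHS]big_seq; apply: eq_bigr => p /tE[p1 p2].
  rewrite centerE ?tZ ?memvM // mulr_sumr.
  by apply: eq_bigr => q _; rewrite !mulrA.
rewrite exchange_big /s mulr_sumr big_seq [RHS]big_seq.
apply: eq_bigr => q /tE[q1 q2].
by rewrite -!mulr_suml -/(sandwich t q.1) -/(tau q.1) (centerE (tZ q1)) //
  mulrA.
Qed.

Lemma frobenius_expandr y :
  y \in E -> \sum_(p <- t) tau (y * p.1) * p.2 = s * y.
Proof.
move=> Ey; rewrite -[s]mul1r -frobenius_expandl ?division_mem1 // mulr_suml.
transitivity (\sum_(p <- t) \sum_(q <- t) q.1 * y * (p.1 * q.2 * p.2)).
  apply: eq_bigr => p _; rewrite mulr_suml.
  by apply: eq_bigr => q _; rewrite !mulrA.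
rewrite exchange_big big_seq [RHS]big_seq; apply: eq_bigr => q /tE[q1 q2].
rewrite -mulr_sumr -/(sandwich t q.2) mulr1.
by rewrite -[tau _ * _ * _]mulrA [RHS](centerE (tZ q2)) ?memvM.
Qed.

(** The form tau need not be symmetric, but [s] is fixed by its Nakayama
    automorphism: both sides are sum_p tau p.1 * tau (p.2 * x), contracted once
    by each of the two expansions. *)
Lemma frobenius_twist x : x \in E -> tau (s * x) = tau (x * s).
Proof.
move=> Ex; rewrite -frobenius_expandl // -[s]mulr1.
rewrite -frobenius_expandr ?division_mem1 // mulr_suml /tau !linear_sum /=.
rewrite big_seq [RHS]big_seq; apply: eq_bigr => p /tE[p1 p2].
have p2x : p.2 * x \in E by rewrite memvM.
rewrite mul1r -mulrA (sandwich_center _ (tZ p1)) //.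
by rewrite (sandwich_center _ (tZ p2x)) // (centerE (tZ p1)) ?mem_sandwich.
Qed.

End Casimir.

(** If the element [s] vanishes, the expansion [frobenius_expandl] is a linear
    dependence over the centre between the left factors. Its coefficient at a
    pair [p] with p.2 != 0 is nonzero for a suitable [y], so p.1 can be
    eliminated, which shortens the list and leaves the operator unchanged. *)
Lemma exists_frobenius_sandwich : exists t, let tau := sandwich t in
  [/\ over t, {in E, forall x, tau x \in 'Z(E)%VS}
    & \sum_(p <- t) tau p.1 * p.2 != 0].
Proof.
have [t [tE tZ [x Ex nz]]] := exists_central_sandwich.
have [n] := ubnP (size t).
elim: n => // n IHn in t tE tZ nz * => le_tn.
have [s0|] := eqVneq (\sum_(p <- t) sandwich t p.1 * p.2) 0; last by exists t.
have /hasP[p tp nzp] : has (fun p => p.2 != 0) t.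
  apply: contraR nz => /hasPn t0; rewrite /sandwich big_seq big1 // => p /t0.
  by rewrite negbK => /eqP->; rewrite mulr0.
have [p1 p2] := tE p tp.
(* This choice makes the coefficient of p.1 equal to tau x, which is nonzero. *)
pose y := p.2^-1 * x.
have Ey : y \in E by rewrite memvM ?memvV.
have py : sandwich t (p.2 * y) = sandwich t x.
  by rewrite mulrA divrr ?mul1r ?unitE.
pose u := (sandwich t x)^-1.
pose z (q : A * A) := u * sandwich t (q.2 * y).
have Pt : perm_eq t (p :: rem p t) by exact: perm_to_rem.
have sub q : q \in rem p t -> q \in t by exact: mem_rem.
have zE q : q \in rem p t -> z q \in 'Z(E)%VS.
  move=> /sub/tE[q1 q2].
  apply: (@memvM _ _ 'Z(E)%AS); last by apply: tZ; exact: memvM.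
  by rewrite memvV; exact: tZ Ex.
have p1E : p.1 = - \sum_(q <- rem p t) z q * q.1.
  have := frobenius_expandl tE tZ Ey.
  rewrite s0 mulr0 (perm_big _ Pt) big_cons py /= => /eqP.
  rewrite addr_eq0 => /eqP/(congr1 ( *%R u)).
  rewrite mulKr ?unitE ?mem_sandwich // => ->; rewrite mulrN mulr_sumr.
  by congr (- _); apply: eq_bigr => q _; rewrite /z mulrA.
pose t' := [seq (q.1, q.2 - z q * p.2) | q <- rem p t].
have zZ : {subset 'Z(E)%VS <= E} by exact/subvP/centerv_sub.
have t'E x' : x' \in E -> sandwich t' x' = sandwich t x'.
  move=> Ex'; rewrite /sandwich big_map (perm_big _ Pt) big_cons /= p1E.
  rewrite mulNr mulNr !mulr_suml addrC -sumrB big_seq [RHS]big_seq.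
  apply: eq_bigr => q tq; have [q1 q2] := tE _ (sub _ tq).
  rewrite mulrBr; congr (_ - _).
  by rewrite mulrA -(centerE (zE q tq)) ?memvM // !mulrA.
apply: (IHn t').
- move=> _ /mapP[q tq ->] /=; have [q1 q2] := tE _ (sub _ tq).
  split=> //; apply: memvB => //; apply: memvM => //; exact: zZ (zE q tq).
- by move=> x' Ex'; rewrite t'E ?tZ.
- by rewrite t'E.
- by move: le_tn; rewrite (perm_size Pt) /= size_map.
Qed.

Section Balanced.

Variable t : seq (A * A).
Hypotheses (tE : over t) (tZ : {in E, forall x, sandwich t x \in 'Z(E)%VS}).

Let tau := sandwich t.
Let s := \sum_(p <- t) tau p.1 * p.2.

Hypothesis nz_s : s != 0.

(** The Casimir identity sum_p c p.1 (x) p.2 = sum_p p.1 (x) p.2 c over the centre.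
    Tensors over the centre are tested against an arbitrary balanced biadditive
    map [beta], which avoids constructing the tensor product. *)
Lemma casimir_balanced (beta : A -> A -> A) c :
    (forall (r : seq (A * A)) F b,
      beta (\sum_(q <- r) F q) b = \sum_(q <- r) beta (F q) b) ->
    (forall (r : seq (A * A)) F a,
      beta a (\sum_(q <- r) F q) = \sum_(q <- r) beta a (F q)) ->
    {in 'Z(E)%VS, forall z a b, beta (z * a) b = beta a (z * b)} ->
    c \in E ->
  \sum_(p <- t) beta (c * p.1) p.2 = \sum_(p <- t) beta p.1 (p.2 * c)
    :> A.
Proof.
move=> sumL sumR bal Ec.
have Es : s \in E by exact: mem_frobenius_scalar.
have Us : s \is a GRing.unit by exact: unitE.
(* Expand c * p.1 along the left factors q.1, with the help of s^-1. *)
transitivity (\sum_(p <- t) \sum_(q <- t)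
    beta q.1 (tau (s^-1 * q.2 * c * p.1) * p.2)).
  rewrite big_seq [RHS]big_seq; apply: eq_bigr => p /tE[p1 p2].
  have Ey : c * p.1 / s \in E by rewrite !memvM ?memvV.
  rewrite -{1}(mulrVK Us (c * p.1)) -frobenius_expandl // sumL.
  rewrite big_seq [RHS]big_seq; apply: eq_bigr => q /tE[q1 q2].
  pose x := s^-1 * q.2 * c * p.1 / s.
  have Ex : x \in E by rewrite !memvM ?memvV.
  have -> : q.2 * (c * p.1 / s) = s * x by rewrite /x !mulrA divrr ?mul1r.
  rewrite (frobenius_twist tE tZ Ex) /x mulrVK // bal //.
  by apply: tZ; rewrite !memvM ?memvV.
rewrite exchange_big big_seq [RHS]big_seq; apply: eq_bigr => q /tE[q1 q2].
rewrite -sumR frobenius_expandr ?memvM ?memvV //.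
by rewrite !mulrA divrr ?mul1r.
Qed.

End Balanced.

(** The two nonvanishing claims hold because m * s and s are sums of multiples
    of values of the two operators: writing tau p.1 as a sandwich and letting it
    commute with [m], or with p.2, regroups the double sum around them. *)
Lemma exists_casimir :
  {in 'Z(E)%VS, forall z x, z * x = x * z} ->
  exists t,
  [/\ over t,
      {in E, forall c m, c * sandwich t m = sandwich t m * c},
      forall m, m != 0 -> exists2 d, d \in E & sandwich t (d * m) != 0,
      {in E, forall c m, sandwich (flip t) (c * m) = sandwich (flip t) (m * c)}
    & exists2 x, x \in E & sandwich (flip t) x != 0].
Proof.
move=> central; have [t [tE tZ nz_s]] := exists_frobenius_sandwich.
pose s := \sum_(p <- t) sandwich t p.1 * p.2.
have Es : s \in E by exact: mem_frobenius_scalar.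
exists t; split=> //.
- move=> c Ec m; rewrite mulr_sumr mulr_suml.
  under eq_bigr do rewrite !mulrA.
  under [RHS]eq_bigr do rewrite -mulrA.
  apply: (casimir_balanced tE tZ nz_s (beta := fun a b => a * m * b)) => //.
  + by move=> r F b; rewrite !mulr_suml.
  + by move=> r F b; rewrite mulr_sumr.
  + by move=> z Zz a b; rewrite (central _ Zz b) -!mulrA (central _ Zz) !mulrA.
- move=> m nzm.
  have /hasP[q tq nzq] : has (fun q => sandwich t (q.2 * m) != 0) t.
    apply: contraR nzm => /hasPn t0; apply/eqP/(mulIr (unitE Es nz_s)).
    rewrite mul0r mulr_sumr.
    transitivity (\sum_(p <- t) \sum_(q <- t) q.1 * (p.1 * (q.2 * m) * p.2)).
      rewrite big_seq [RHS]big_seq; apply: eq_bigr => p /tE[p1 p2].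
      rewrite mulrA -(central _ (tZ _ p1)) !mulr_suml.
      by apply: eq_bigr => q _; rewrite !mulrA.
    rewrite exchange_big big_seq big1 // => q /t0.
    rewrite negbK -mulr_sumr -/(sandwich t (q.2 * m)) => /eqP ->.
    by rewrite mulr0.
  by exists q.2; have [] := tE q tq.
- move=> c Ec m; rewrite !sandwich_flip.
  under eq_bigr do rewrite mulrA.
  under [RHS]eq_bigr do rewrite mulrA -[_ * _ * _]mulrA.
  apply/esym.
  apply: (casimir_balanced tE tZ nz_s (beta := fun a b => b * m * a)) => //.
  + by move=> r F b; rewrite mulr_sumr.
  + by move=> r F b; rewrite !mulr_suml.
  + by move=> z Zz a b; rewrite mulrA -(central _ Zz) !mulrA.
- have /hasP[q tq nzq] : has (fun q => sandwich (flip t) q.1 != 0) t.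
    apply: contraR nz_s => /hasPn t0; apply/eqP.
    transitivity (\sum_(p <- t) \sum_(q <- t) p.2 * q.1 * p.1 * q.2).
      rewrite big_seq [RHS]big_seq; apply: eq_bigr => p /tE[p1 p2].
      rewrite (central _ (tZ _ p1)) mulr_sumr.
      by apply: eq_bigr => q _; rewrite !mulrA.
    rewrite exchange_big big_seq big1 // => q /t0.
    rewrite negbK -mulr_suml -(sandwich_flip t) => /eqP ->.
    by rewrite mul0r.
  by exists q.1; have [] := tE q tq.
Qed.

End DivisionSubalgebra.

(** * Homogeneous components *)

Section Grading.

Variables (k : fieldType) (G : groupType) (A : falgType k).
Variable D : G -> {vspace A}.
Hypothesis gradD : is_graded_algebra D.

Lemma mem_grading_mul g h x y :
  x \in D g -> y \in D h -> x * y \in D (g * h)%g.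
Proof.
move=> Dx Dy; apply: (subvP (grading_mul gradD g h)).
exact: memv_mul.
Qed.

Lemma grading_cap0 g s :
  uniq (g :: s) -> (D g :&: \sum_(h <- s) D h)%VS = 0%VS.
Proof.
move=> Us; apply/eqP; rewrite -subv0 -(dimv_add_leqif (D g) _).2.
have /directvP/= := grading_direct gradD Us.
have /andP[_ /(grading_direct gradD)/directvP/= dimS] := Us.
by rewrite !big_cons -dimS => ->.
Qed.

Lemma grading_sum0 (s : seq G) (y : G -> A) :
    uniq s -> (forall g, y g \in D g) -> \sum_(g <- s) y g = 0 ->
  {in s, forall g, y g = 0}.
Proof.
move=> Us Dy s0 g sg; have Ps := perm_to_rem sg.
have Ug : uniq (g :: rem g s) by rewrite -(perm_uniq Ps).
apply/eqP; rewrite -memv0 -(grading_cap0 Ug) memv_cap Dy /=.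
move: s0; rewrite (perm_big _ Ps) big_cons /= => /eqP.
rewrite addr_eq0 => /eqP->; rewrite memvN.
by elim/big_rec2: _ => [|h V v _ Vv]; rewrite ?mem0v ?memv_add.
Qed.

Lemma grading_sum_sub (s1 s2 : seq G) : {subset s1 <= s2} ->
  (\sum_(g <- s1) D g <= \sum_(g <- s2) D g)%VS.
Proof.
elim: s1 => [|g s1 IHs] s12; first by rewrite big_nil sub0v.
rewrite big_cons subv_add; apply/andP; split.
  have Ps := perm_to_rem (s12 g (mem_head _ _)).
  by rewrite (perm_big _ Ps) big_cons addvSl.
by apply: IHs => h s1h; apply: s12; rewrite inE s1h orbT.
Qed.

Lemma grading_finite_support :
  exists2 s, uniq s & forall x, x \in (\sum_(g <- s) D g)%VS.
Proof.
have cover (X : seq A) :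
    exists s : seq G, {subset X <= (\sum_(g <- s) D g)%VS}.
  elim: X => [|x X [s IHs]]; first by exists [::].
  have [s' s'x] := grading_span gradD x; exists (s' ++ s) => y.
  rewrite inE => /predU1P[->|/IHs]; first apply: subvP s'x.
  - by apply: grading_sum_sub => g; rewrite mem_cat => ->.
  - by apply/subvP/grading_sum_sub => g; rewrite mem_cat orbC => ->.
have [s sX] := cover (vbasis fullv).
exists (undup s) => [|x]; first exact: undup_uniq.
have /span_subvP : {subset vbasis fullv <= (\sum_(g <- undup s) D g)%VS}.
  move=> y /sX; apply/subvP/grading_sum_sub => g.
  by rewrite mem_undup.
by rewrite (span_basis (vbasisP _)) => /subvP; apply; rewrite memvf.
Qed.

(** Only finitely many components are nonzero, and those cover the algebra; the
    projections attached to that finite direct sum extend to all degrees, since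
    a component outside the support is zero. *)
Lemma homogeneous_projections : exists pi : G -> 'End(A),
  [/\ forall g x, pi g x \in D g,
      forall g h x, x \in D h -> pi g x = if g == h then x else 0
    & exists s : seq G, forall x, x = \sum_(g <- s) pi g x].
Proof.
have [s Us sX] := grading_finite_support.
pose pi g := sumv_pi_for (erefl (\sum_(g <- s) D g)%VS) g.
have piD g x : pi g x \in D g by exact: memv_sum_pi.
have piE x : x = \sum_(g <- s) pi g x.
  by rewrite sumv_pi_uniq_sum ?filter_predT.
exists pi; split=> //; last by exists s.
have D0 g x : g \notin s -> x \in D g -> x = 0.
  move=> sg Dx; apply/eqP; rewrite -memv0 -(@grading_cap0 g s) /= ?sg //.
  by rewrite memv_cap Dx sX.
move=> g h x Dx; have [sg|sg] := boolP (g \in s); last first.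
  rewrite (D0 g (pi g x)) //; case: eqP => // gh; apply/esym/(D0 g) => //.
  by rewrite gh.
have [sh|sh] := boolP (h \in s); last first.
  by rewrite (D0 h x) // linear0 if_same.
pose y f := pi f x - (if f == h then x else 0).
apply/eqP; rewrite -subr_eq0; apply/eqP.
apply: (grading_sum0 Us (y := y)) => //.
  by move=> f; rewrite memvB //; case: eqP => [->|_]; rewrite ?mem0v.
rewrite sumrB -piE (bigD1_seq h) //= eqxx big1 ?addr0 ?subrr // => f /negPf->.
by [].
Qed.


Lemma homogeneous_linear_eq (V : vectType k) (f h : 'Hom(A, V)) :
  (forall g, {in D g, f =1 h}) -> f =1 h.
Proof.
have [pi [piD _ [s piS]]] := homogeneous_projections => fh x.
by rewrite (piS x) !linear_sum; apply: eq_bigr => g _; apply: (fh g).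
Qed.

Section Projections.

Variable pi : G -> 'End(A).
Hypotheses (piD : forall g x, pi g x \in D g)
  (piE : forall g h x, x \in D h -> pi g x = if g == h then x else 0).

Lemma homogeneous_proj_mull g h x y :
  x \in D g -> pi (g * h)%g (x * y) = x * pi h y.
Proof.
move=> Dx; pose f := (pi (g * h)%g \o amull x)%VF.
pose f' := (amull x \o pi h)%VF.
suff: f =1 f' by move/(_ y); rewrite !comp_lfunE !lfunE.
apply: homogeneous_linear_eq => h' z Dz; rewrite !comp_lfunE !lfunE /=.
rewrite (piE _ (mem_grading_mul Dx Dz)) (piE _ Dz) (inj_eq (mulgI g)).
by case: eqP; rewrite ?mulr0.
Qed.

(** By [homogeneous_proj_mull], the component of 1 of degree 1 is a right unit
    for homogeneous elements, hence for all elements, including 1 itself. *)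
Lemma homogeneous_one : 1 \in D 1%g.
Proof.
suff /(_ 1): amulr (pi 1%g 1) =1 (\1%VF : 'End(A)).
  by rewrite !lfunE /= mul1r => <-.
apply: homogeneous_linear_eq => g x Dx; rewrite !lfunE /=.
by rewrite -(homogeneous_proj_mull 1%g 1 Dx) mulr1 mulg1 (piE _ Dx) eqxx.
Qed.

Lemma homogeneous_inv g x :
  x \in D g -> x \is a GRing.unit -> x^-1 \in D g^-1%g.
Proof.
move=> Dx Ux; have := homogeneous_proj_mull g^-1%g x^-1 Dx.
rewrite mulgV mulrV // (piE _ homogeneous_one) eqxx => xK.
by rewrite -[x^-1]mulr1 xK mulKr.
Qed.

End Projections.

End Grading.

(** * Symmetric forms and bimodule isomorphisms with the dual *)

Section SymmetricForm.

Variables (k : fieldType) (A : falgType k).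
Implicit Type lam : 'Hom(A, k^o).

Lemma exists_linear_form (v : A) :
  v != 0 -> exists xi : 'Hom(A, k^o), xi v != 0.
Proof.
move=> nzv; have vE := coord_vbasis (memvf v).
have [/existsP[i nzi]|/existsPn v0] :=
  boolP [exists i, coord (vbasis fullv) i v != 0].
  by exists (linfun (coord (vbasis fullv) i : A -> k^o)); rewrite lfunE.
case/eqP: nzv; rewrite vE big1 // => i _.
by move: (v0 i); rewrite negbK => /eqP->; rewrite scale0r.
Qed.

Definition form_dual (lam : 'Hom(A, k^o)) (a : A) : 'Hom(A, k^o) :=
  (lam \o amulr a)%VF.

Lemma form_dualE lam a x : form_dual lam a x = lam (x * a).
Proof. by rewrite comp_lfunE lfunE. Qed.

Lemma form_dual_is_linear lam : linear (form_dual lam).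
Proof.
move=> c a b; apply/lfunP => x.
by rewrite add_lfunE scale_lfunE !form_dualE mulrDr -scalerAr linearP.
Qed.

HB.instance Definition _ lam := GRing.isLinear.Build k A 'Hom(A, k^o) _
  (form_dual lam) (form_dual_is_linear lam).

Lemma form_dual_bijective lam :
  (forall a, a != 0 -> exists x, lam (x * a) != 0) -> bijective (form_dual lam).
Proof.
move=> ndeg; pose f := linfun (form_dual lam).
have fE a : f a = form_dual lam a by rewrite lfunE.
have kerf : lker f == 0%VS.
  rewrite -subv0; apply/subvP => a; rewrite memv_ker memv0 fE => /eqP fa0.
  apply: contraT => /ndeg[x].
  by rewrite -form_dualE fa0 zero_lfunE eqxx.
have imgf : limg f = fullv.
  apply/eqP; rewrite eqEdim subvf limg_dim_eq ?(eqP kerf) ?capv0 //.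
  by rewrite !dimvf /dim /= muln1.
exists (f^-1)%VF => [a|h]; first by rewrite -fE lker0_lfunK.
by rewrite -fE limg_lfunVK ?imgf ?memvf.
Qed.

Lemma graded_symmetric_of_form (G : groupType) (D : G -> {vspace A})
    (lam : 'Hom(A, k^o)) :
    is_graded_algebra D ->
    (forall x y, lam (x * y) = lam (y * x)) ->
    (forall g, g != 1%g -> {in D g, forall x, lam x = 0}) ->
    (forall a, a != 0 -> exists x, lam (x * a) != 0) ->
  graded_symmetric D.
Proof.
move=> gradD lamC lam0 ndeg; pose phi := form_dual lam.
have phil a x : phi (a * x) = dual_lmul a (phi x).
  by apply/lfunP => y; rewrite dual_lmulE !form_dualE mulrA.
have phir a x : phi (x * a) = dual_rmul (phi x) a.
  by apply/lfunP => y; rewrite dual_rmulE !form_dualE mulrA lamC mulrA.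
have phiD g x : x \in D g -> dual_component D g (phi x).
  move=> Dx h /eqP hg y Dy; rewrite form_dualE.
  apply: (lam0 (h * g)%g); last exact: mem_grading_mul.
  by apply: contra hg => /eqP/mulg1_eq<-; rewrite invgK.
by exists phi; split; first exact: form_dual_bijective.
Qed.

End SymmetricForm.

(** * Graded division algebras *)

Section GradedDivision.

Variables (k : fieldType) (G : groupType) (A : falgType k).
Variable D : G -> {vspace A}.
Hypothesis divD : is_graded_division_algebra D.
Let gradD := gdiv_graded divD.
Hypothesis centralD : {in 'Z(D 1%g)%VS, forall z x, z * x = x * z}.

Lemma neutral_aspace : exists E : {aspace A}, E = D 1%g :> {vspace A}.
Proof.
have [pi [piD piE _]] := homogeneous_projections gradD.
have D1 : is_aspace (D 1%g).
  rewrite /is_aspace has_algid1 ?(homogeneous_one gradD piD piE) //=.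
  by have := grading_mul gradD 1%g 1%g; rewrite mulg1.
by exists (ASpace D1).
Qed.

(** On degree 1 the form is a linear form composed with the flipped Casimir
    operator, so it kills commutators of D 1. For nonzero [x] in D g, the Casimir
    operator yields a nonzero [u] in D g that commutes with D 1; writing x = b * u
    with [b] in D 1 reduces the commutator of [x] and [y] to one inside D 1. *)
Lemma exists_symmetric_form : exists lam : 'Hom(A, k^o),
  [/\ forall x y, lam (x * y) = lam (y * x),
      forall g, g != 1%g -> {in D g, forall x, lam x = 0}
    & exists2 x, x \in D 1%g & lam x != 0].
Proof.
have [pi [piD piE _]] := homogeneous_projections gradD.
have inD g x : x \in D g -> x != 0 -> x^-1 \in D g^-1%g.
  move=> Dx nzx; have Ux := gdiv_unit divD Dx nzx.
  exact: (homogeneous_inv gradD piD piE Dx Ux).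
have [E E1] := neutral_aspace.
have unitE : {in E, forall x, x != 0 -> x \is a GRing.unit}.
  by move=> x; rewrite E1; apply: (gdiv_unit divD).
have central : {in 'Z(E)%VS, forall z x, z * x = x * z} by rewrite E1.
have [t [tE tC tnz tT [x0 Ex0 nz0]]] := exists_casimir unitE central.
have [xi nzxi] := exists_linear_form nz0.
pose lam := (xi \o (linfun (sandwich (flip t)) \o pi 1%g))%VF.
have lamE x : x \in D 1%g -> lam x = xi (sandwich (flip t) x).
  by move=> Dx; rewrite !comp_lfunE (piE _ _ _ Dx) eqxx lfunE.
have lam0 g : g != 1%g -> {in D g, forall x, lam x = 0}.
  move=> g1 x Dx; rewrite !comp_lfunE (piE _ _ _ Dx) eq_sym (negPf g1).
  by rewrite !linear0.
have lamT : {in D 1%g &, forall x y, lam (x * y) = lam (y * x)}.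
  move=> x y Dx Dy; have := mem_grading_mul gradD.
  move=> /(_ 1%g 1%g) DM; rewrite mulg1 in DM.
  by rewrite !lamE ?DM // tT // E1.
clearbody lam; exists lam.
split=> //; last by exists x0; rewrite -?E1 // lamE -?E1.
suff lamC g h x y : x \in D g -> y \in D h -> lam (x * y) = lam (y * x).
  move=> x y.
  suff /(_ x) : (lam \o amulr y)%VF =1 (lam \o amull y)%VF.
    by rewrite !comp_lfunE !lfunE.
  apply: (homogeneous_linear_eq gradD) => g {}x Dx.
  suff /(_ y) : (lam \o amull x)%VF =1 (lam \o amulr x)%VF.
    by rewrite !comp_lfunE !lfunE.
  apply: (homogeneous_linear_eq gradD) => h {}y Dy.
  by rewrite !comp_lfunE !lfunE; exact: lamC Dx Dy.
move=> Dx Dy; have [gh|gh] := eqVneq (g * h)%g 1%g; last first.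
  rewrite (lam0 _ gh) ?(mem_grading_mul gradD) //.
  rewrite (lam0 (h * g)%g) ?(mem_grading_mul gradD) //.
  apply: contra gh => /eqP/mulg1_eq<-.
  by rewrite mulVg.
have {h gh Dy}Dy : y \in D g^-1%g by rewrite (mulg1_eq gh).
have [->|nzx] := eqVneq x 0; first by rewrite mulr0 mul0r.
have [d Ed nzu] := tnz x nzx.
set u := sandwich t (d * x) in nzu.
have Du : u \in D g.
  rewrite /u /sandwich big_seq; apply: memv_suml => p /tE[].
  rewrite E1 in Ed * => p1 p2; rewrite -[g]mulg1 -[(g * 1)%g]mul1g mulgA.
  by rewrite !(mem_grading_mul gradD) // -[g]mul1g (mem_grading_mul gradD).
have Uu : u \is a GRing.unit by exact: (gdiv_unit divD Du nzu).
pose b := x / u.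
have Db : b \in D 1%g by rewrite -(mulgV g) (mem_grading_mul gradD) // inD.
have xE : x = b * u by rewrite /b mulrVK.
have Dyb : y * b \in D g^-1%g.
  by rewrite -[g^-1%g]mulg1 (mem_grading_mul gradD).
have Dvu : y * b * u \in D 1%g.
  by rewrite -(mulVg g) (mem_grading_mul gradD).
have uC : u * (y * b) = y * b * u.
  (* Both sides agree after multiplication by [u], which commutes with D 1. *)
  by apply: (mulIr Uu); rewrite -[LHS]mulrA -[LHS]tC // E1.
rewrite xE -mulrA lamT //.
  by rewrite -mulrA uC mulrA.
by rewrite -(mulgV g) (mem_grading_mul gradD).
Qed.

End GradedDivision.

Theorem theorem5p5 (k : fieldType) (G : groupType) (Delta : falgType k)
    (D : G -> {vspace Delta}) :
  is_graded_division_algebra D ->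
  'Z(D 1%g)%VS = ('Z(fullv : {vspace Delta}) :&: D 1%g)%VS ->
  graded_symmetric D.
Proof.
move=> divD ZD; have gradD := gdiv_graded divD.
have centralD : {in 'Z(D 1%g)%VS, forall z x, z * x = x * z}.
  move=> z; rewrite ZD !memv_cap => /andP[/andP[_ /centvP zC] _] x.
  by rewrite zC ?memvf.
have [lam [lamC lam0 [x0 Dx0 nzx0]]] := exists_symmetric_form divD centralD.
apply: (graded_symmetric_of_form gradD lamC lam0) => a nza.
have [pi [piD piE [s piS]]] := homogeneous_projections gradD.
have /hasP[g _ nzg] : has (fun g => pi g a != 0) s.
  apply: contraR nza => /hasPn pi0; rewrite (piS a) big_seq big1 // => g /pi0.
  by rewrite negbK => /eqP.
have Ug : pi g a \is a GRing.unit by exact: (gdiv_unit divD (piD g a) nzg).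
(* The multiplier that brings the component of [a] of degree g to x0. *)
have Dx : x0 / pi g a \in D g^-1%g.
  rewrite -[g^-1%g]mul1g (mem_grading_mul gradD) //.
  exact: (homogeneous_inv gradD piD piE).
exists (x0 / pi g a); apply: contra nzx0 => /eqP lam_eq0.
have lam1 y : lam y = lam (pi 1%g y).
  suff /(_ y) : lam =1 (lam \o pi 1%g)%VF by rewrite comp_lfunE.
  apply: (homogeneous_linear_eq gradD) => h {}y Dy.
  rewrite comp_lfunE (piE _ _ _ Dy) eq_sym; case: eqVneq => // h1.
  by rewrite linear0 (lam0 h).
rewrite -(mulrVK Ug x0) -(homogeneous_proj_mull gradD piE g a Dx) mulVg.
by rewrite -lam1 lam_eq0.
Qed.
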